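(* Let $V$ be a $\mathbb Q$-graded vertex operator algebra. (a) $O(V)$ is a two-sided ideal of $V$ with respect to the product $*$, and $A(V)=V/O(V)$ is an associative algebra with identity $\mathbf 1+O(V)$; moreover $\omega+O(V)$ lies in the center of $A(V)$. (b) For any weak $V$-module $M$, $\Omega(M)$ is an $A(V)$-module on which $a+O(V)$ acts as $o(a)$.
   Context: A $\mathbb Q$-graded vertex operator algebra $V=\oplus_{\alpha\in\mathbb Q}V_\alpha$ satisfies all axioms of a vertex operator algebra (vacuum $\mathbf 1$, conformal vector $\omega$, $L(0)$ acting on $V_\alpha$ by $\alpha$, Jacobi identity, etc.) except that the grading is by $\mathbb Q$ instead of $\mathbb Z$; ${\rm wt}\,a=\alpha$ for $a\in V_\alpha$. A weak $V$-module is a vector space $M$ with $Y_M:V\to({\rm End}M)[[z,z^{-1}]]$, $Y_M(a,z)=\sum a_nz^{-n-1}$, such that $Y_M(\mathbf 1,z)={\rm id}$, $Y_M(a,z)u\in M((z))$, $Y_M(L(-1)a,z)=\frac{d}{dz}Y_M(a,z)$, and the Jacobi identity holds. For homogeneous $a$ let $\varepsilon(a)=1$ if ${\rm wt}\,a\in\mathbb Z$ and $\varepsilon(a)=0$ otherwise, and $[\cdot]$ the greatest-integer function. Define $a*b=\varepsilon(a)\,{\rm Res}_x\frac{(1+x)^{[{\rm wt}a]}}{x}Y(a,x)b$ for homogeneous $a$, extended bilinearly; $O(V)$ is the span of ${\rm Res}_x\frac{(1+x)^{[{\rm wt}a]}}{x^{1+\varepsilon(a)}}Y(a,x)b$ for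 homogeneous $a\in V$, $b\in V$. For a weak module $M$, $\Omega(M)=\{u\in M: a_mu=0$ for all homogeneous $a$ and $m>{\rm wt}\,a-1\}$, and $o(a)=\varepsilon(a)a_{[{\rm wt}a]-1}$ for homogeneous $a$, extended linearly. *)

(* Defs.v *)
From Stdlib Require Import ClassicalEpsilon.
From HB Require Import structures.
From mathcomp Require Import all_boot all_order all_algebra.
Set Implicit Arguments. Unset Strict Implicit. Unset Printing Implicit Defensive.
Import Order.TTheory GRing.Theory Num.Theory.
Local Open Scope ring_scope.

(* Sum of a finitely supported sequence f : nat -> W, i.e. sum_{i>=0} f i
   (a bound N with f i = 0 for i >= N is chosen by choice; the value does not
   depend on the choice when such a bound exists). *)
Definition fbound (W : zmodType) (f : nat -> W) : nat :=
  epsilon (inhabits 0%N) (fun N => forall i : nat, (N <= i)%N -> f i = 0).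
Definition fsum (W : zmodType) (f : nat -> W) : W :=
  \sum_(i < fbound f) f i.

Definition binz (K : fieldType) (m : int) (i : nat) : K :=
  (\prod_(j < i) ((m - (j : nat)%:Z)%:~R : K)) / (i`!)%:R.

Definition epsq (al : rat) : bool := denq al == 1.
Definition epsz (al : rat) : int := if epsq al then 1 else 0.

(* Borcherds (component-wise Jacobi) identity for Yv : V -> V -> V components
   and Ym : V -> M -> M components: for all a b in V, u in M, m n k : int,
   sum_i binom(m,i) (a_{k+i} b)_{m+n-i} u
     = sum_i (-1)^i binom(k,i) (a_{m+k-i} b_{n+i} u - (-1)^k b_{n+k-i} a_{m+i} u).
   This is the coefficient of z0^{-k-1} z1^{-m-1} z2^{-n-1} in the Jacobi
   identity. *)
Definition jacobi (K : fieldType) (V M : lmodType K)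
  (Yv : V -> int -> V -> V) (Ym : V -> int -> M -> M) : Prop :=
  forall (a b : V) (u : M) (m n k : int),
    fsum (fun i : nat => binz K m i *: Ym (Yv a (k + i%:Z) b) (m + n - i%:Z) u)
    = fsum (fun i : nat => ((-1) ^+ i * binz K k i) *:
              (Ym a (m + k - i%:Z) (Ym b (n + i%:Z) u)
               - ((-1) ^ k) *: Ym b (n + k - i%:Z) (Ym a (m + i%:Z) u))).

Record QVOA (K : fieldType) (V : lmodType K) := {
  vac : V;
  om : V;
  cc : K;
  gproj : rat -> V -> V;
  Y : V -> int -> V -> V;        (* Y a n b = a_n b *)
  gproj_lin : forall al (k : K) (u v : V), gproj al (k *: u + v) = k *: gproj al u + gproj al v;
  gproj_orth : forall al be v, gproj al (gproj be v) = if al == be then gproj al v else 0;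
  gproj_fin : forall v, exists s : seq rat, uniq s /\ v = \sum_(al <- s) gproj al v;
  gproj_findim : forall al, exists s : seq V, forall v, gproj al v = v ->
      exists c : nat -> K, v = \sum_(i < size s) c i *: nth 0 s i;
  gproj_low : exists be : rat, forall al v, al < be -> gproj al v = 0;
  Y_linl : forall (k : K) a a' n b, Y (k *: a + a') n b = k *: Y a n b + Y a' n b;
  Y_linr : forall (k : K) a n b b', Y a n (k *: b + b') = k *: Y a n b + Y a n b';
  Y_trunc : forall a b, exists N : int, forall n, N <= n -> Y a n b = 0;
  vac_hom : gproj 0 vac = vac;
  Y_vac : forall n v, Y vac n v = if n == -1 then v else 0;
  Y_creation : forall a, (forall n, 0 <= n -> Y a n vac = 0) /\ Y a (-1) vac = a;
  (* conformal vector, L(n) = omega_{n+1} *)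
  om_hom : gproj 2%:Q om = om;
  virasoro : forall (m n : int) v,
      Y om (m + 1) (Y om (n + 1) v) - Y om (n + 1) (Y om (m + 1) v)
      = (m - n)%:~R *: Y om (m + n + 1) v
        + (if m + n == 0 then (((m ^+ 3 - m)%:~R / 12%:R) * cc) *: v else 0);
  L0_grade : forall al v, gproj al v = v -> Y om 1 v = ratr al *: v;
  L_1_deriv : forall a n b, Y (Y om 0 a) n b = (- n)%:~R *: Y a (n - 1) b;
  Y_jacobi : jacobi Y Y
}.

Section Zhu.
Variables (K : fieldType) (V : lmodType K) (A : QVOA V).

Definition homog (al : rat) (a : V) : Prop := gproj A al a = a.

Definition gsupp (a : V) : seq rat :=
  epsilon (inhabits [::]) (fun s => uniq s /\ a = \sum_(al <- s) gproj A al a).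

(* a * b for a homogeneous of weight al:
   eps(a) Res_x (1+x)^[wt a]/x Y(a,x) b *)
Definition starh (al : rat) (a b : V) : V :=
  if epsq al then fsum (fun i : nat => binz K (Num.floor al) i *: Y A a (i%:Z - 1) b)
  else 0.

Definition star (a b : V) : V :=
  \sum_(al <- gsupp a) starh al (gproj A al a) b.

(* Res_x (1+x)^[wt a]/x^{1+eps(a)} Y(a,x) b, a homogeneous of weight al *)
Definition resO (al : rat) (a b : V) : V :=
  fsum (fun i : nat => binz K (Num.floor al) i *: Y A a (i%:Z - 1 - epsz al) b).

Definition OV (v : V) : Prop :=
  exists s : seq (K * rat * V * V),
    (forall t, t \in s -> homog t.1.1.2 t.1.2) /\
    v = \sum_(t <- s) t.1.1.1 *: resO t.1.1.2 t.1.2 t.2.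

End Zhu.

Record wmod (K : fieldType) (V : lmodType K) (A : QVOA V) (M : lmodType K) := {
  YM : V -> int -> M -> M;
  YM_linl : forall (k : K) a a' n u, YM (k *: a + a') n u = k *: YM a n u + YM a' n u;
  YM_linr : forall (k : K) a n u u', YM a n (k *: u + u') = k *: YM a n u + YM a n u';
  YM_trunc : forall a u, exists N : int, forall n, N <= n -> YM a n u = 0;
  YM_vac : forall n u, YM (vac A) n u = if n == -1 then u else 0;
  YM_L_1_deriv : forall a n u, YM (Y A (om A) 0 a) n u = (- n)%:~R *: YM a (n - 1) u;
  YM_jacobi : jacobi (Y A) YM
}.

Section Omega.
Variables (K : fieldType) (V : lmodType K) (A : QVOA V) (M : lmodType K) (W : wmod A M).

Definition Omega (u : M) : Prop :=
  forall (al : rat) (a : V), homog A al a ->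
    forall m : int, al - 1 < m%:~R -> YM W a m u = 0.

Definition oact (a : V) (u : M) : M :=
  \sum_(al <- gsupp A a)
     (if epsq al then YM W (gproj A al a) (Num.floor al - 1) u else 0).

End Omega.

(* Main.v *)
Require Import Defs.
From Stdlib Require Import ClassicalEpsilon FunctionalExtensionality.
From mathcomp Require Import all_boot all_order all_algebra.
From mathcomp Require Import zify ring lra.
Import Order.TTheory GRing.Theory Num.Theory.
Local Open Scope ring_scope.
Set Implicit Arguments.
Unset Strict Implicit.

(** Everything in part (a) rests on one consequence of the Jacobi identity,
obtained by pairing it with the test function
(1 + z1)^p (1 + z2)^q z2^n (z1 - z2)^k: on the left z1 = z2 + z0, so that
Res (1 + z2)^(wt - l) Y(a_{k+l} b, z2) c appears with exactly the exponent
dictated by the weight of a_{k+l} b.  With k = n = -1 it gives associativity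
modulo O(V), with k = -1 - eps(a) it shows that O(V) is a right ideal, and with
k = 0 that Res (1 + x)^(wt a - 1) Y(a, x) preserves O(V).  Skew symmetry together with
L(-1) v = - (wt v) v modulo O(V) gives
a * b - b * a = Res (1 + x)^(wt a - 1) Y(a, x) b modulo O(V); the left ideal
property and the centrality of omega follow.  Homogeneous elements of
nonintegral weight lie in O(V), since they equal Res_x of
(1 + x)^[wt a] x^(-1) Y(a, x) 1, and the fractional parts of two nonintegral
weights with integral sum add up to 1, which is what makes the exponents match
in the mixed case.  Part (b) only needs the Jacobi identity itself with k = -1,
k = -1 - eps(a) and k = 0, because on Omega(M) almost all terms vanish. *)

(** * Generalized binomial coefficients with integer upper index *)

Section Binomials.
Variable K : fieldType.
Hypothesis K0 : [pchar K] =i pred0.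

Lemma natr_neq0 (n : nat) : n.+1%:R != 0 :> K.
Proof. by rewrite (pcharf0P K).1. Qed.

Lemma binz0 m : binz K m 0 = 1.
Proof. by rewrite /binz big_ord0 fact0 divr1. Qed.

Lemma mulr_divfactS i (x : K) : i.+1%:R * (x / (i.+1)`!%:R) = x / i`!%:R.
Proof.
rewrite mulrCA factS natrM invfM; congr (_ * _).
by rewrite mulrA divff ?mul1r ?natr_neq0.
Qed.

(** Kept free of division: the inductions below multiply by [i.+1] and cancel it in characteristic
    zero. *)
Lemma binzS m i : i.+1%:R * binz K m i.+1 = (m - i%:Z)%:~R * binz K m i.
Proof. by rewrite mulr_divfactS big_ord_recr /= mulrA [X in X / _]mulrC. Qed.

Lemma binz_absorb m i : i.+1%:R * binz K (m + 1) i.+1 = (m + 1)%:~R * binz K m i.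
Proof.
rewrite mulr_divfactS big_ord_recl /= subr0 /binz mulrA; congr (_ * _ / _).
by apply: eq_bigr => j _; congr (_%:~R); rewrite /bump; lia.
Qed.

(** Chu-Vandermonde. After multiplication by [s.+1], split as i + (s + 1 - i), [binzS] lowers one
    binomial in each half, and the halves recombine through (p - i) + (q - (s - i)) = p + q - s. *)
Lemma binz_vandermonde p q s :
  \sum_(i < s.+1) binz K p i * binz K q (s - i) = binz K (p + q) s.
Proof.
elim: s => [|s IH]; first by rewrite big_ord1 !binz0 mulr1.
apply: (mulfI (natr_neq0 s)); rewrite binzS -IH !mulr_sumr.
transitivity (\sum_(i < s.+2) (i%:R * binz K p i * binz K q (s.+1 - i)
   + binz K p i * ((s.+1 - i)%:R * binz K q (s.+1 - i)))).
  apply: eq_bigr => i _.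
  have -> : s.+1%:R = i%:R + (s.+1 - i)%:R :> K.
    by rewrite -natrD subnKC // -ltnS.
  ring.
rewrite big_split /= big_ord_recl /= !mul0r add0r.
rewrite [X in _ + X]big_ord_recr /= subnn mul0r mulr0 addr0 -big_split /=.
apply: eq_bigr => i _.
have le_is : (i <= s)%N by rewrite -ltnS.
rewrite /bump /= add1n subSS binzS (subSn le_is) binzS.
rewrite (_ : p + q - s%:Z = (p - i%:Z) + (q - (s - i)%N%:Z)); last lia.
rewrite intrD; ring.
Qed.

Lemma binz_nn n : binz K n%:Z n = 1.
Proof.
elim: n => [|n IH]; first by rewrite binz0.
apply: (mulfI (natr_neq0 n)).
have e : n.+1%:Z = n%:Z + 1 by lia.
by rewrite {1}e binz_absorb IH -e.
Qed.

Lemma binz_small (n i : nat) : (n < i)%N -> binz K n%:Z i = 0.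
Proof. by move=> lt_ni; rewrite /binz (bigD1 (Ordinal lt_ni)) //= subrr !mul0r. Qed.

(** Two ways to read the coefficient of z0^l z2^i in (1 + z2 + z0)^p: through powers of z2 + z0, or
    through powers of z0 over 1 + z2. *)
Lemma binz_trinomial p l i :
  binz K p (l + i) * binz K (l + i)%:Z l = binz K p l * binz K (p - l%:Z) i.
Proof.
elim: i => [|i IH]; first by rewrite addn0 binz_nn binz0.
apply: (mulfI (natr_neq0 i)).
rewrite [RHS]mulrCA binzS mulrCA [in RHS](mulrCA (binz K p l)) -IH addnS.
have -> : i.+1%:R * binz K (l + i).+1%:Z l
   = (l + i).+1%:R * binz K (l + i)%:Z l.
  have := binzS (l + i).+1%:Z l.
  rewrite {1}(_ : (l + i).+1%:Z = (l + i)%:Z + 1); last lia.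
  rewrite binz_absorb (_ : (l + i).+1%:Z - l%:Z = i.+1%:Z); last lia.
  by rewrite (_ : (l + i)%:Z + 1 = (l + i).+1%:Z) //; lia.
rewrite mulrCA mulrA binzS (_ : p - (l + i)%N%:Z = p - l%:Z - i%:Z); last lia.
by rewrite -mulrA.
Qed.

(** Upper negation: reverse the order of the [s] factors and change the sign of each. *)
Lemma binz_neg m s : (-1) ^+ s * binz K (s%:Z - m) s = binz K (m - 1) s.
Proof.
rewrite /binz mulrA; congr (_ / _).
rewrite (reindex_inj rev_ord_inj) /= -[s in _ ^+ s]card_ord -prodrN.
apply: eq_bigr => j _; rewrite -mulrNz; congr (_%:~R).
by have := ltn_ord j; lia.
Qed.

Lemma binzN1 s : binz K (-1) s = (-1) ^+ s.
Proof. by have := binz_neg 0 s; rewrite subr0 binz_nn mulr1 sub0r => <-. Qed.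

Lemma binz_0 i : binz K 0 i = (i == 0%N)%:R.
Proof. by case: i => [|i]; [rewrite binz0 | rewrite (@binz_small 0)]. Qed.

End Binomials.

(** * Finitely supported sums and their rearrangement *)

Section FiniteSums.
Variable W : zmodType.
Implicit Types f g : nat -> W.

Definition finsupp f := exists N : nat, forall i, (N <= i)%N -> f i = 0.
(** Bounding [i + j] keeps finite both orders of summation and the summation along antidiagonals. *)
Definition finsupp2 (f : nat -> nat -> W) :=
  exists N : nat, forall i j, (N <= i + j)%N -> f i j = 0.

Lemma sum_ord_trunc f (M N : nat) : (forall i, (M <= i)%N -> f i = 0) -> (M <= N)%N ->
  \sum_(i < N) f i = \sum_(i < M) f i.
Proof.
move=> fM leMN; rewrite -!(big_mkord xpredT f).
rewrite (big_cat_nat (n := M)) //= [X in _ + X]big_nat_cond [X in _ + X]big1 ?addr0 // => i.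
by move=> /andP[/andP[/fM -> _] _].
Qed.

(** Any valid bound may replace the chosen one, since the two partial sums differ only by zero
    terms. *)
Lemma fsumE (N : nat) f : (forall i, (N <= i)%N -> f i = 0) -> fsum f = \sum_(i < N) f i.
Proof.
move=> fN.
have fb : forall i, (fbound f <= i)%N -> f i = 0.
  exact: (epsilon_spec (inhabits 0%N) (fun N => forall i : nat, (N <= i)%N -> f i = 0)
    (ex_intro _ N fN)).
rewrite /fsum; case: (leqP N (fbound f)) => [le|/ltnW le].
  exact: sum_ord_trunc.
exact/esym/sum_ord_trunc.
Qed.

Lemma eq_fsum f g : f =1 g -> fsum f = fsum g.
Proof. by move=> /functional_extensionality ->. Qed.

Lemma fsumD f g : finsupp f -> finsupp g -> fsum (fun i => f i + g i) = fsum f + fsum g.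
Proof.
case=> N fN [M gM]; rewrite !(@fsumE (maxn N M)) ?big_split //= => i;
  by rewrite geq_max => /andP[/fN hf /gM hg]; rewrite ?hf ?hg ?addr0.
Qed.

Lemma fsum0 f : f =1 (fun=> 0) -> fsum f = 0.
Proof. by move=> f0; rewrite (@fsumE 0) ?big_ord0. Qed.

Lemma fsum_head f : (forall i, f i.+1 = 0) -> fsum f = f 0%N.
Proof. by move=> f0; rewrite (@fsumE 1) ?big_ord1 // => -[]. Qed.

Lemma fsum_closed (P : W -> Prop) f : P 0 -> (forall x y, P x -> P y -> P (x + y)) ->
  (forall i, P (f i)) -> P (fsum f).
Proof. by move=> P0 PD Pf; rewrite /fsum; apply: big_ind => // i _. Qed.

Lemma finsupp2_col (f : nat -> nat -> W) j : finsupp2 f -> finsupp (fun i => f i j).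
Proof. by case=> N fN; exists N => i le; apply: fN; lia. Qed.

Lemma finsupp2_row (f : nat -> nat -> W) i : finsupp2 f -> finsupp (f i).
Proof. by case=> N fN; exists N => j le; apply: fN; lia. Qed.

Lemma fsum_exchange (f : nat -> nat -> W) : finsupp2 f ->
  fsum (fun i => fsum (f i)) = fsum (fun j => fsum (fun i => f i j)).
Proof.
case=> N fN.
have rowE i : fsum (f i) = \sum_(j < N) f i j.
  by apply: fsumE => j le; apply: fN; lia.
have colE j : fsum (fun i => f i j) = \sum_(i < N) f i j.
  by apply: fsumE => i le; apply: fN; lia.
have sum0 (g : nat -> nat -> W) : (forall k i, (N <= k)%N -> g k i = 0) ->
    fsum (fun k => \sum_(i < N) g k i) = \sum_(k < N) \sum_(i < N) g k i.
  by move=> g0; apply: fsumE => k le; apply: big1 => i _; apply: g0.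
rewrite (eq_fsum rowE) sum0; last by move=> k i le; apply: fN; lia.
rewrite (eq_fsum colE) (sum0 (fun j i => f i j)); last by move=> k i le; apply: fN; lia.
exact: exchange_big.
Qed.

(** Cauchy-product regrouping along i + j = s; it merges two binomial expansions into one. *)
Lemma fsum_triangle (f : nat -> nat -> W) : finsupp2 f ->
  fsum (fun i => fsum (f i)) = fsum (fun s => \sum_(i < s.+1) f i (s - i)%N).
Proof.
case=> N fN.
have rowE i : fsum (f i) = \sum_(j < N) f i j.
  by apply: fsumE => j le; apply: fN; lia.
rewrite (eq_fsum rowE) (@fsumE N); last first.
  by move=> i le; apply: big1 => j _; apply: fN; lia.
rewrite (@fsumE N (fun s => \sum_(i < s.+1) _)); last first.
  by move=> s le; apply: big1 => -[i lt] _; apply: fN => /=; lia.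
transitivity (\sum_(s < N) \sum_(i < N | (i <= s)%N) f i (s - i)%N); last first.
  apply: eq_bigr => s _.
  by rewrite (@big_ord_widen_cond _ _ _ _ N xpredT (fun i => f i (s - i)%N)) //=;
     apply: eq_bigl => i; rewrite ltnS.
rewrite [RHS](exchange_big_dep xpredT) //=; apply: eq_bigr => i _.
rewrite (@sum_ord_trunc _ (N - i)) ?leq_subr //; last by move=> k le; apply: fN; lia.
rewrite -(big_geq_mkord i N xpredT (fun s => f i (s - i)%N)) /=.
rewrite -[X in \sum_(X <= _ < _) _]add0n big_addn big_mkord.
by apply: eq_bigr => s _; rewrite addnK.
Qed.

Lemma fsum_recl f : finsupp f -> fsum f = f 0%N + fsum (fun i => f i.+1).
Proof.
case=> N fN; rewrite (@fsumE N.+1); last by move=> i /ltnW /fN.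
rewrite big_ord_recl (@fsumE N) // => i le.
by apply: fN; apply: leqW.
Qed.

(** The bound on [j] may depend on [i], but only the finitely many rows below [L] matter, so a
    common bound exists. Truncation of fields supplies finiteness in this form. *)
Lemma finsupp2_intro (f : nat -> nat -> W) :
  (exists L : nat, forall i j, (L <= i)%N -> f i j = 0) -> (forall i, finsupp (f i)) -> finsupp2 f.
Proof.
move=> [L fL] fT.
have [T fLT] : exists T : nat, forall i j, (i < L)%N -> (T <= j)%N -> f i j = 0.
  elim: {fL} L => [|L [T IH]]; first by exists 0%N.
  have [T' hT'] := fT L; exists (maxn T T') => i j; rewrite geq_max ltnS leq_eqVlt.
  by move=> /orP[/eqP -> /andP[_ /hT'] // | /IH h /andP[/h]].
exists (L + T)%N => i j le; case: (leqP L i) => [/fL -> //| lt].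
by apply: fLT => //; lia.
Qed.

Lemma finsupp_fsum (f : nat -> nat -> W) : finsupp2 f -> finsupp (fun i => fsum (f i)).
Proof. by case=> N fN; exists N => i le; apply: fsum0 => j; apply: fN; lia. Qed.

Definition finsupp3 (f : nat -> nat -> nat -> W) :=
  exists N : nat, forall i j k, (N <= i + j + k)%N -> f i j k = 0.

Lemma finsupp3_slice (f : nat -> nat -> nat -> W) i : finsupp3 f -> finsupp2 (f i).
Proof. by case=> N fN; exists N => j k le; apply: fN; lia. Qed.

Lemma finsupp2_fsum (f : nat -> nat -> nat -> W) : finsupp3 f -> finsupp2 (fun i j => fsum (f i j)).
Proof. by case=> N fN; exists N => i j le; apply: fsum0 => k; apply: fN; lia. Qed.

(** Suited to two fields applied to a vector: the inner one truncates [i + k] uniformly, the outer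
    one truncates [j] for each [i] and [k]. *)
Lemma finsupp3_intro (f : nat -> nat -> nat -> W) :
  (exists L : nat, forall i j k, (L <= i + k)%N -> f i j k = 0) ->
  (forall i k, finsupp (fun j => f i j k)) -> finsupp3 f.
Proof.
move=> [L fL] fT.
have [T fLT] : exists T : nat, forall i j k, (i < L)%N -> (k < L)%N -> (T <= j)%N -> f i j k = 0.
  have h i : exists T : nat, forall j k, (T <= k + j)%N -> f i j k = 0.
    have [|//|T hT] := @finsupp2_intro (fun k j => f i j k).
      by exists L => k j le; apply: fL; lia.
    by exists T => j k; apply: hT.
  elim: {1}L => [|M [T IH]]; first by exists 0%N.
  have [T' hT'] := h M; exists (maxn T T') => i j k; rewrite geq_max ltnS leq_eqVlt.
  move=> /orP[/eqP -> _ /andP[_ le]|lt ltk /andP[/(IH _ _ _ lt ltk)]//].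
  by apply: hT'; lia.
exists (L + T)%N => i j k le; case: (leqP L (i + k)) => [/fL -> //| lt].
by apply: fLT => //; lia.
Qed.

End FiniteSums.

Lemma fsum_morph (W U : zmodType) (h : W -> U) (f : nat -> W) :
  {morph h : x y / x + y} -> finsupp f -> h (fsum f) = fsum (fun i => h (f i)).
Proof.
move=> hD [N fN].
have h0 : h 0 = 0.
  by have := hD 0 0; rewrite addr0 => /eqP; rewrite addrC -subr_eq subrr eq_sym => /eqP.
rewrite (fsumE fN) (@fsumE _ N) ?(big_morph h hD h0) //.
by move=> i /fN ->.
Qed.

Lemma finsuppZ (K : fieldType) (W : lmodType K) (c : nat -> K) (f : nat -> W) :
  finsupp f -> finsupp (fun i => c i *: f i).
Proof. by case=> N fN; exists N => i /fN ->; rewrite scaler0. Qed.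

Lemma fsumZ (K : fieldType) (W : lmodType K) (c : K) (f : nat -> W) :
  finsupp f -> c *: fsum f = fsum (fun i => c *: f i).
Proof. by apply: fsum_morph => x y; rewrite scalerDr. Qed.

Lemma finsuppN (W : zmodType) (f : nat -> W) : finsupp f -> finsupp (fun i => - f i).
Proof. by case=> N fN; exists N => i /fN ->; rewrite oppr0. Qed.

Lemma fsumN (W : zmodType) (f : nat -> W) : finsupp f -> - fsum f = fsum (fun i => - f i).
Proof. by apply: fsum_morph => x y; rewrite opprD. Qed.

Lemma fsumB (W : zmodType) (f g : nat -> W) : finsupp f -> finsupp g ->
  fsum (fun i => f i - g i) = fsum f - fsum g.
Proof. by move=> hf hg; rewrite fsumN // -fsumD //; apply: finsuppN. Qed.

Lemma sqr_signz (K : fieldType) (k : int) : (-1 : K) ^ k * (-1) ^ k = 1.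
Proof. by rewrite -expfzMl mulrNN mulr1 exp1rz. Qed.

(** * Residues of fields and the residue form of the Jacobi identity *)

Section Residues.
Variables (K : fieldType) (V : lmodType K) (A : QVOA V).
Hypothesis K0 : [pchar K] =i pred0.
Implicit Types a b c : V.

Lemma scalerC (x y : K) (v : V) : x *: (y *: v) = y *: (x *: v).
Proof. by rewrite !scalerA mulrC. Qed.

Lemma YDr a n b b' : Y A a n (b + b') = Y A a n b + Y A a n b'.
Proof. by have := Y_linr A 1 a n b b'; rewrite !scale1r. Qed.
Lemma YDl a a' n b : Y A (a + a') n b = Y A a n b + Y A a' n b.
Proof. by have := Y_linl A 1 a a' n b; rewrite !scale1r. Qed.
Lemma Y0r a n : Y A a n 0 = 0.
Proof. by apply: (addIr (Y A a n 0)); rewrite -YDr !add0r. Qed.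
Lemma Y0l n b : Y A 0 n b = 0.
Proof. by apply: (addIr (Y A 0 n b)); rewrite -YDl !add0r. Qed.
Lemma YZr k a n b : Y A a n (k *: b) = k *: Y A a n b.
Proof. by have := Y_linr A k a n b 0; rewrite Y0r !addr0. Qed.
Lemma YZl k a n b : Y A (k *: a) n b = k *: Y A a n b.
Proof. by have := Y_linl A k a 0 n b; rewrite Y0l !addr0. Qed.

Lemma Y_truncn (q : int) a b : exists N : nat, forall i : nat, (N <= i)%N -> Y A a (q + i%:Z) b = 0.
Proof.
by have [N hN] := Y_trunc A a b; exists `|N - q|%N => i le; apply: hN; lia.
Qed.

(* Res_x (1 + x)^p x^q Y(a, x) b *)
Definition res (p q : int) a b : V := fsum (fun i : nat => binz K p i *: Y A a (q + i%:Z) b).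

Lemma res_finsupp p q a b : finsupp (fun i : nat => binz K p i *: Y A a (q + i%:Z) b).
Proof. exact/finsuppZ/Y_truncn. Qed.

Lemma resDr p q a b b' : res p q a (b + b') = res p q a b + res p q a b'.
Proof.
rewrite -fsumD; try exact: res_finsupp.
by apply: eq_fsum => i; rewrite YDr scalerDr.
Qed.

Lemma resDl p q a a' b : res p q (a + a') b = res p q a b + res p q a' b.
Proof.
rewrite -fsumD; try exact: res_finsupp.
by apply: eq_fsum => i; rewrite YDl scalerDr.
Qed.

Lemma resZr p q k a b : res p q a (k *: b) = k *: res p q a b.
Proof.
rewrite fsumZ; last exact: res_finsupp.
by apply: eq_fsum => i; rewrite YZr !scalerA mulrC.
Qed.

Lemma resZl p q k a b : res p q (k *: a) b = k *: res p q a b.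
Proof.
rewrite fsumZ; last exact: res_finsupp.
by apply: eq_fsum => i; rewrite YZl !scalerA mulrC.
Qed.

Lemma res0l p q b : res p q 0 b = 0.
Proof. by rewrite -[0 in LHS](scale0r (0 : V)) resZl scale0r. Qed.

Lemma res0r p q a : res p q a 0 = 0.
Proof. by rewrite -[0 in LHS](scale0r (0 : V)) resZr scale0r. Qed.

Lemma res_truncn p (q : int) a b :
  exists N : nat, forall j : nat, (N <= j)%N -> res p (q + j%:Z) a b = 0.
Proof.
have [N hN] := Y_truncn q a b; exists N => j le; apply: fsum0 => i.
by rewrite -addrA -PoszD hN ?scaler0 //; lia.
Qed.

(** Expand the factor (1 + x)^q alone; Vandermonde reassembles the two binomials. *)
Lemma res_addp p q n a b :
  res (p + q) n a b = fsum (fun j : nat => binz K q j *: res p (n + j%:Z) a b).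
Proof.
have [N hN] := Y_truncn n a b.
pose f (j i : nat) := (binz K p i * binz K q j) *: Y A a (n + j%:Z + i%:Z) b.
have ff : finsupp2 f.
  by exists N => i j le; rewrite /f -addrA -PoszD hN ?scaler0 //; lia.
transitivity (fsum (fun j => fsum (f j))); last first.
  apply: eq_fsum => j; rewrite fsumZ; last exact: res_finsupp.
  by apply: eq_fsum => i; rewrite scalerA mulrC.
rewrite fsum_triangle //; apply: eq_fsum => s.
rewrite addrC -binz_vandermonde // scaler_suml; apply: eq_bigr => i _.
rewrite /f mulrC; congr (_ *: Y A a _ b).
by have := ltn_ord i; lia.
Qed.

Lemma resSp p q a b : res (p + 1) q a b = res p q a b + res p (q + 1) a b.
Proof.
rewrite res_addp (@fsumE _ 2).
  by rewrite !big_ord_recl big_ord0 /= binz0 scale1r !addr0 (@binz_nn K K0 1) scale1r.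
by move=> i lt; rewrite (@binz_small K 1) ?scale0r.
Qed.

(** The right side sums the left side of the Borcherds identity at [i], [n + j], [k] with the
    coefficients of (1 + z1)^p (1 + z2)^q. Substituting z1 = z2 + z0 and expanding in z0 leaves (1 +
    z2)^(p - l + q). *)
Lemma res_jacobi_lhs (p q n k : int) a b c :
  fsum (fun l : nat => binz K p l *: res (p - l%:Z + q) n (Y A a (k + l%:Z) b) c)
  = fsum (fun j : nat => binz K q j *: fsum (fun i : nat => binz K p i *:
      fsum (fun l : nat => binz K i%:Z l *:
        Y A (Y A a (k + l%:Z) b) (i%:Z + (n + j%:Z) - l%:Z) c))).
Proof.
have [L hL] := Y_truncn k a b.
transitivity (fsum (fun l : nat => fsum (fun j : nat =>
  binz K p l *: (binz K q j *: res (p - l%:Z) (n + j%:Z) (Y A a (k + l%:Z) b) c)))).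
  apply: eq_fsum => l; rewrite res_addp fsumZ //; apply: finsuppZ.
  exact: res_truncn.
rewrite fsum_exchange; last first.
  apply: finsupp2_intro.
    by exists L => l j le; rewrite hL // res0l !scaler0.
  by move=> l; apply/finsuppZ/finsuppZ/res_truncn.
apply: eq_fsum => j.
have fl : finsupp (fun l : nat => binz K p l *: res (p - l%:Z) (n + j%:Z) (Y A a (k + l%:Z) b) c).
  by exists L => l le; rewrite hL // res0l scaler0.
transitivity (binz K q j *:
   fsum (fun l : nat => binz K p l *: res (p - l%:Z) (n + j%:Z) (Y A a (k + l%:Z) b) c)).
  by rewrite fsumZ //; apply: eq_fsum => l; rewrite !scalerA mulrC.
congr (_ *: _).
pose f (l i : nat) := (binz K p l * binz K (p - l%:Z) i) *:
   Y A (Y A a (k + l%:Z) b) (n + j%:Z + i%:Z) c.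
have ff : finsupp2 f.
  apply: finsupp2_intro.
    by exists L => l i le; rewrite /f hL // Y0l scaler0.
  by move=> l; apply/finsuppZ/Y_truncn.
transitivity (fsum (fun l => fsum (f l))).
  apply: eq_fsum => l; rewrite fsumZ; last exact: res_finsupp.
  by apply: eq_fsum => i; rewrite scalerA.
rewrite fsum_triangle //; apply: eq_fsum => i.
(* binom(i, l) vanishes for l > i, so the inner sum is exactly the antidiagonal produced by
   [fsum_triangle]. *)
rewrite (@fsumE _ i.+1); last by move=> l lt; rewrite binz_small ?scale0r.
rewrite scaler_sumr; apply: eq_bigr => l _.
rewrite /f -binz_trinomial // scalerA subnKC; last by rewrite -ltnS.
congr (_ *: Y A _ _ c).
by have := ltn_ord l; lia.
Qed.

(** Coefficients of (1 - x)^k: they expand (z1 - z2)^k in one domain and, up to the sign (-1)^k, in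
    the other. *)
Definition sbinz (k : int) (r : nat) : K := (-1) ^+ r * binz K k r.

Lemma res_fsumr p q a (f : nat -> V) : finsupp f ->
  res p q a (fsum f) = fsum (fun i => res p q a (f i)).
Proof. by apply: fsum_morph => x y; rewrite resDr. Qed.

Lemma YY_finsupp3 (m n k : int) a b c :
  finsupp3 (fun j i r : nat => Y A a (i%:Z + m + k - r%:Z) (Y A b (n + j%:Z + r%:Z) c)).
Proof.
apply: finsupp3_intro.
  have [L hL] := Y_truncn n b c; exists L => j i r le.
  by rewrite -(addrA n) -PoszD hL ?Y0r.
move=> j r; have [N hN] := Y_truncn (m + k - r%:Z) a (Y A b (n + j%:Z + r%:Z) c).
by exists N => i /hN; rewrite (_ : m + k - r%:Z + i%:Z = i%:Z + m + k - r%:Z) //; lia.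
Qed.

(** Handles both products on the right of the Borcherds identity, the second one with the roles of
    [a], [p] and [b], [q] exchanged. *)
Lemma fsum_YY (p q m n k : int) a b c :
  fsum (fun j : nat => binz K q j *: fsum (fun i : nat => binz K p i *:
    fsum (fun r : nat => sbinz k r *:
      Y A a (i%:Z + m + k - r%:Z) (Y A b (n + j%:Z + r%:Z) c))))
  = fsum (fun r : nat => sbinz k r *: res p (m + k - r%:Z) a (res q (n + r%:Z) b c)).
Proof.
pose g (j r : nat) := binz K q j *:
  (sbinz k r *: res p (m + k - r%:Z) a (Y A b (n + j%:Z + r%:Z) c)).
have fg : finsupp2 g.
  have [L hL] := Y_truncn n b c; exists L => j r le.
  by rewrite /g -(addrA n) -PoszD hL ?res0r ?scaler0.
transitivity (fsum (fun j => fsum (g j))).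
  apply: eq_fsum => j.
  have f2 := finsupp3_slice j (YY_finsupp3 m n k a b c).
  transitivity (binz K q j *: fsum (fun r : nat =>
     sbinz k r *: res p (m + k - r%:Z) a (Y A b (n + j%:Z + r%:Z) c))); last first.
    rewrite fsumZ //; apply: finsuppZ.
    have [L hL] := Y_truncn n b c; exists L => r le.
    by rewrite -(addrA n) -PoszD hL ?res0r //; lia.
  congr (_ *: _).
  pose h (i r : nat) := binz K p i *: (sbinz k r *:
     Y A a (i%:Z + m + k - r%:Z) (Y A b (n + j%:Z + r%:Z) c)).
  transitivity (fsum (fun i => fsum (h i))).
    by apply: eq_fsum => i; rewrite fsumZ //; apply/finsuppZ/(finsupp2_row i f2).
  rewrite fsum_exchange; last first.
    by case: f2 => N hN; exists N => i r /hN e; rewrite /h e !scaler0.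
  apply: eq_fsum => r; rewrite fsumZ; last exact: res_finsupp.
  apply: eq_fsum => i; rewrite /h !scalerA mulrC.
  by congr (_ *: Y A a _ _); lia.
rewrite fsum_exchange //; apply: eq_fsum => r.
rewrite res_fsumr ?fsumZ; try exact: res_finsupp.
  by apply: eq_fsum => j; rewrite resZr /g !scalerA mulrC;
     congr (_ *: res _ _ _ (Y A b _ c)); lia.
have [N hN] := Y_truncn (n + r%:Z) b c.
by exists N => j le; rewrite hN ?scaler0 ?res0r.
Qed.

(* The test function behind this identity is
   (1 + z1)^p (1 + z2)^q z2^n (z1 - z2)^k, expanded in the three domains of the
   Jacobi identity; on the left z1 = z2 + z0. *)
Lemma res_jacobi (p q n k : int) a b c :
  fsum (fun l : nat => binz K p l *: res (p - l%:Z + q) n (Y A a (k + l%:Z) b) c)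
  = fsum (fun r : nat => sbinz k r *: res p (k - r%:Z) a (res q (n + r%:Z) b c))
  - (-1) ^ k *: fsum (fun r : nat => sbinz k r *: res q (n + k - r%:Z) b (res p r%:Z a c)).
Proof.
pose F (j i r : nat) := sbinz k r *: Y A a (i%:Z + 0 + k - r%:Z) (Y A b (n + j%:Z + r%:Z) c).
pose G (j i r : nat) := sbinz k r *: Y A b (j%:Z + n + k - r%:Z) (Y A a (0 + i%:Z + r%:Z) c).
have FF : finsupp3 F.
  by have [N hN] := YY_finsupp3 0 n k a b c; exists N => i j r /hN; rewrite /F => ->; rewrite scaler0.
have GG : finsupp3 G.
  have [N hN] := YY_finsupp3 n 0 k b a c; exists N => i j r le.
  by rewrite /G hN ?scaler0 //; lia.
rewrite res_jacobi_lhs.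
transitivity (fsum (fun j : nat => binz K q j *: fsum (fun i : nat => binz K p i *: fsum (F j i)))
  - (-1) ^ k *: fsum (fun j : nat => binz K q j *: fsum (fun i : nat => binz K p i *: fsum (G j i)))); last first.
  congr (_ - _ *: _).
    rewrite fsum_YY; apply: eq_fsum => r.
    by rewrite add0r.
  transitivity (fsum (fun i => binz K p i *: fsum (fun j => binz K q j *: fsum (G j i)))).
    pose H (j i : nat) := binz K q j *: (binz K p i *: fsum (G j i)).
    have HH : finsupp2 H.
      by have [N hN] := finsupp2_fsum GG; exists N => i j /hN; rewrite /H => ->; rewrite !scaler0.
    transitivity (fsum (fun j => fsum (H j))).
      apply: eq_fsum => j; rewrite fsumZ //.
      exact/finsuppZ/(finsupp2_row j (finsupp2_fsum GG)).
    rewrite fsum_exchange //; apply: eq_fsum => i; rewrite fsumZ.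
      by apply: eq_fsum => j; rewrite /H !scalerA mulrC.
    exact/finsuppZ/(finsupp2_col i (finsupp2_fsum GG)).
  rewrite fsum_YY; apply: eq_fsum => r.
  by rewrite add0r.
have F1 j := finsupp2_row j (finsupp2_fsum FF); have G1 j := finsupp2_row j (finsupp2_fsum GG).
have inner (E : nat -> nat -> nat -> V) : finsupp3 E ->
    finsupp (fun j => fsum (fun i => binz K p i *: fsum (E j i))).
  move=> /finsupp2_fsum [N hN]; exists N => j le; apply: fsum0 => i.
  by rewrite hN ?scaler0 //; lia.
have outer := fun E HE => @finsuppZ _ _ (binz K q) _ (inner E HE).
rewrite fsumZ -?fsumB; [|exact: outer| |exact: outer]; last first.
  exact/(@finsuppZ _ _ (fun=> _))/outer.
apply: eq_fsum => j.
rewrite [X in _ - X]scalerC -scalerBr; congr (_ *: _).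
rewrite fsumZ -?fsumB; try exact: finsuppZ; last exact/(@finsuppZ _ _ (fun=> _))/finsuppZ.
apply: eq_fsum => i.
rewrite [X in _ - X]scalerC -scalerBr; congr (_ *: _).
have F2 := finsupp2_row i (finsupp3_slice j FF); have G2 := finsupp2_row i (finsupp3_slice j GG).
(* The two sides now correspond term by term in [i] and [j]: this is the Borcherds identity at [i],
   [n + j], [k]. *)
rewrite Y_jacobi fsumZ // -fsumB //; last exact: (@finsuppZ _ _ (fun=> _)).
apply: eq_fsum => r.
rewrite /F /G scalerBr addr0 add0r; congr (_ - _).
by rewrite scalerC; congr (_ *: (_ *: Y A b _ _)); lia.
Qed.

End Residues.

(** * The rationals inside a field of characteristic zero *)

Section RationalScalars.
Variable K : fieldType.
Hypothesis K0 : [pchar K] =i pred0.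

Lemma intr_neq0 (n : int) : n != 0 -> n%:~R != 0 :> K.
Proof.
case: n => [[|n] // _|n _]; first exact: natr_neq0.
by rewrite NegzE mulrNz oppr_eq0; apply: natr_neq0.
Qed.

(** [ratr] is read off the reduced fraction; this lets any relation x d = n be used instead, which
    gives additivity by cross-multiplication. *)
Lemma ratr_mul_int (x : rat) (n d : int) : x * d%:~R = n%:~R ->
  ratr x * d%:~R = n%:~R :> K.
Proof.
move=> xd; have dK : (denq x)%:~R != 0 :> K by apply: intr_neq0.
have e : numq x * d = n * denq x.
  apply: (@intr_inj rat); rewrite !intrM -xd -{2}[x]divq_num_den.
  by rewrite mulrAC divfK // intr_eq0.
apply: (mulIf dK); rewrite -intrM -e intrM /ratr.
by rewrite mulrAC divfK.
Qed.

Lemma ratr_add (x y : rat) : ratr (x + y) = ratr x + ratr y :> K.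
Proof.
have dx : (denq x)%:~R != 0 :> K by apply: intr_neq0.
have dy : (denq y)%:~R != 0 :> K by apply: intr_neq0.
have dxQ : (denq x)%:~R != 0 :> rat by rewrite intr_eq0.
have dyQ : (denq y)%:~R != 0 :> rat by rewrite intr_eq0.
apply: (mulIf (mulf_neq0 dx dy)); rewrite -intrM.
rewrite (@ratr_mul_int _ (numq x * denq y + numq y * denq x)).
  rewrite /ratr intrD !intrM; move: dx dy.
  move: (numq x)%:~R (numq y)%:~R (denq x)%:~R (denq y)%:~R => a c b d b0 d0.
  by field; rewrite b0 d0.
rewrite intrD !intrM -{1}[x]divq_num_den -{1}[y]divq_num_den; move: dxQ dyQ.
move: (numq x)%:~R (numq y)%:~R (denq x)%:~R (denq y)%:~R => a c b d b0 d0.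
by field; rewrite b0 d0.
Qed.

Lemma ratr_injective : injective (@ratr K).
Proof.
move=> x y e; apply/eqP; rewrite -subr_eq0.
have : ratr (x - y) = 0 :> K.
  by apply: (addIr (ratr y)); rewrite add0r -ratr_add subrK.
have dK : (denq (x - y))%:~R != 0 :> K by apply: intr_neq0.
rewrite /ratr => /eqP; rewrite mulf_eq0 invr_eq0 (negPf dK) orbF => h.
by rewrite -numq_eq0; apply: contraTT h; apply: intr_neq0.
Qed.

End RationalScalars.

(** * Integral parts of weights *)

Section Weights.

Lemma epsq_int (n : int) : epsq n%:~R.
Proof. by rewrite /epsq denq_int. Qed.

Lemma floor_epsq al : epsq al -> al = (Num.floor al)%:~R.
Proof. by move=> h; rewrite floorK. Qed.

Lemma epsqDz (al : rat) (n : int) : epsq (al + n%:~R) = epsq al.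
Proof.
have h x m : epsq x -> epsq (x + m%:~R) by move=> /floor_epsq ->; rewrite -intrD epsq_int.
by apply/idP/idP => [/(h _ (- n))|/h //]; rewrite mulrNz addrK.
Qed.

Lemma floorDz (al : rat) (n : int) : Num.floor (al + n%:~R) = Num.floor al + n.
Proof. by rewrite floorDrz ?intrKfloor. Qed.

Lemma epszDz (al : rat) (n : int) : epsz (al + n%:~R) = epsz al.
Proof. by rewrite /epsz epsqDz. Qed.

Lemma epsqD (al be : rat) : epsq al -> epsq (al + be) = epsq be.
Proof. by move=> /floor_epsq ->; rewrite addrC epsqDz. Qed.

(** As [al] is not an integer, n - al lies strictly between n - [al] - 1 and n - [al]. *)
Lemma floor_frac (al be : rat) (n : int) : ~~ epsq al -> al + be = n%:~R ->
  Num.floor be + 1 = n - Num.floor al.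
Proof.
move=> nal e; have {e}-> : be = n%:~R - al by rewrite -e addrC addKr.
suff -> : Num.floor (n%:~R - al) = n - Num.floor al - 1 by rewrite subrK.
have /andP[lo hi] := floor_itv al.
have neq : (Num.floor al)%:~R != al :> rat.
  by apply: contra nal => /eqP <-; apply: epsq_int.
have lt : (Num.floor al)%:~R < al by rewrite lt_neqAle neq.
apply: floor_def; move: hi lt; rewrite subrK !intrD !mulrNz => hi lt.
by apply/andP; split; lra.
Qed.

(** A single formula for two integral weights and for two nonintegral ones, so that later arguments
    treat both cases at once. *)
Lemma floor_eps_complement (al be : rat) (n : int) : al + be = n%:~R ->
  Num.floor be + 1 = n + epsz al - Num.floor al /\ epsz be = epsz al.
Proof.
move=> en; case: (boolP (epsq al)) => h.
  have ebe : epsq be by rewrite -(epsqD _ h) en epsq_int.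
  rewrite /epsz h ebe; split=> //.
  have : n%:~R = (Num.floor al + Num.floor be)%:~R :> rat.
    by rewrite intrD -(floor_epsq h) -(floor_epsq ebe) -en.
  by move=> /intr_inj ->; lia.
rewrite (floor_frac h en) /epsz (negPf h) addr0; split=> //.
suff /negPf -> : ~~ epsq be by [].
by apply: contra h => hb'; rewrite -(epsqD _ hb') addrC en epsq_int.
Qed.

End Weights.

(** * Homogeneous components and weights of modes *)

Section Grading.
Variables (K : fieldType) (V : lmodType K) (A : QVOA V).
Hypothesis K0 : [pchar K] =i pred0.
Implicit Types (a b c v : V) (al be : rat).
Notation gproj := (gproj A).
Notation homog := (homog A).
Notation gsupp := (gsupp A).
Notation Y := (Y A).

Lemma gprojD al u v : gproj al (u + v) = gproj al u + gproj al v.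
Proof. by have := gproj_lin A al 1 u v; rewrite !scale1r. Qed.
Lemma gproj0 al : gproj al 0 = 0.
Proof. by apply: (addIr (gproj al 0)); rewrite -gprojD !add0r. Qed.
Lemma gprojZ al k v : gproj al (k *: v) = k *: gproj al v.
Proof. by have := gproj_lin A al k v 0; rewrite gproj0 !addr0. Qed.
Lemma gproj_sum al (I : Type) (s : seq I) (F : I -> V) :
  gproj al (\sum_(i <- s) F i) = \sum_(i <- s) gproj al (F i).
Proof. exact: (big_morph _ (gprojD al) (gproj0 al)). Qed.

Lemma homog0 al : homog al 0.
Proof. exact: gproj0. Qed.
Lemma homog_gproj al v : homog al (gproj al v).
Proof. by rewrite /homog gproj_orth eqxx. Qed.
Lemma homog_gproj_out al be v : homog al v -> be != al -> gproj be v = 0.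
Proof. by move=> <- /negPf ne; rewrite gproj_orth ne. Qed.

Lemma homog_ind (P : V -> Prop) : (forall u v, P u -> P v -> P (u + v)) ->
  (forall al v, homog al v -> P v) -> forall v, P v.
Proof.
move=> PD Ph v; have [s [_ ->]] := gproj_fin A v.
apply: big_ind => //; first exact: (Ph 0 _ (homog0 0)).
by move=> al _; apply: (Ph al); apply: homog_gproj.
Qed.

(** L(0) commutes with the projections, so the component of weight be of an eigenvector is scaled
    both by be and by [al]; in characteristic zero distinct weights give distinct scalars. *)
Lemma homog_eigen al v : Y (om A) 1 v = ratr al *: v -> homog al v.
Proof.
have [s [_ ev]] := gproj_fin A v.
have L0E be : gproj be (Y (om A) 1 v) = ratr be *: gproj be v.
  rewrite {2}ev {1}ev.
  rewrite (big_morph (Y (om A) 1) (YDr A (om A) 1) (Y0r A (om A) 1)) !gproj_sum scaler_sumr.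
  apply: eq_bigr => ga _; rewrite (L0_grade (homog_gproj ga v)) gprojZ.
  by rewrite gproj_orth; case: eqP => [->|]; rewrite // !scaler0.
move=> e; have out be : be != al -> gproj be v = 0.
  move=> ne; have := L0E be; rewrite e gprojZ => /eqP.
  rewrite -subr_eq0 -scalerBl scaler_eq0 subr_eq0 => /orP[/eqP /(ratr_injective K0) eb|/eqP //].
  by rewrite eb eqxx in ne.
rewrite /Defs.homog {2}ev {1}ev gproj_sum; apply: eq_bigr => be _.
by rewrite gproj_orth; case: eqP => [->|/eqP]//; rewrite eq_sym => /out.
Qed.

(** The Borcherds identity for [om] and [a] with m = 1, k = 0 says [L(0), a_n] = (L(-1)a)_(n+1) +
    (L(0)a)_n, so a_n b is an L(0)-eigenvector with the expected eigenvalue. *)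
Lemma homog_Y al be a b n : homog al a -> homog be b ->
  homog (al + be - n%:~R - 1) (Y a n b).
Proof.
move=> ha hb; apply: homog_eigen.
have := Y_jacobi A (om A) a b 1 n 0.
rewrite (@fsumE _ 2); last by move=> i le; rewrite (@binz_small K 1) ?scale0r.
rewrite fsum_head; last by move=> i; rewrite (@binz_small K 0) // mulr0 scale0r.
rewrite !big_ord_recl big_ord0 /= !binz0 expr0 expr0z mul1r !scale1r.
rewrite (@binz_nn K K0 1) scale1r !addr0 !add0r.
rewrite L_1_deriv (L0_grade ha) (L0_grade hb) YZl YZr.
rewrite (_ : 1 + n - (bump 0 0)%:Z = n); last by rewrite /bump; lia.
move=> /esym/eqP; rewrite subr_eq => /eqP ->.
rewrite -!scalerDl; congr (_ *: _).
rewrite (_ : al + be - n%:~R - 1 = (- (1 + n))%:~R + al + be).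
  by rewrite !ratr_add // ratr_int.
by rewrite mulrNz intrD; ring.
Qed.

Lemma gsuppP v : uniq (gsupp v) /\ v = \sum_(al <- gsupp v) gproj al v.
Proof. exact: (epsilon_spec (inhabits [::]) _ (gproj_fin A v)). Qed.

Lemma gsupp_out al v : al \notin gsupp v -> gproj al v = 0.
Proof.
move=> out; rewrite (gsuppP v).2 gproj_sum big_seq big1 // => be be_in.
by rewrite gproj_orth; case: eqP => // e; rewrite e be_in in out.
Qed.

Section ComponentSums.
Variables (W : lmodType K) (F : rat -> V -> W).
Hypothesis FD : forall al u v, F al (u + v) = F al u + F al v.
Hypothesis FZ : forall al k v, F al (k *: v) = k *: F al v.

(** Common shape of [star] in its first argument and of [oact]; linearity is proved once for
    both. *)
Definition gsum v := \sum_(al <- gsupp v) F al (gproj al v).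

Lemma gsum_sub (s : seq rat) v : uniq s -> (forall al, al \notin s -> gproj al v = 0) ->
  gsum v = \sum_(al <- s) F al (gproj al v).
Proof.
move=> us outs.
have F0 al : F al 0 = 0 by rewrite -(scale0r (0 : V)) FZ scale0r.
have nz (t : seq rat) : \sum_(al <- t) F al (gproj al v)
    = \sum_(al <- filter (fun al => gproj al v != 0) t) F al (gproj al v).
  rewrite big_filter [RHS]big_mkcond; apply: eq_bigr => al _.
  by case: eqP => // ->; rewrite F0.
rewrite /gsum (nz s) nz; apply: perm_big; apply: uniq_perm.
- exact/filter_uniq/(gsuppP v).1.
- exact: filter_uniq.
move=> al; rewrite !mem_filter; case: eqP => //= /eqP ne.
have -> : al \in s by apply: contraNT ne => /outs ->.
by apply: contraNT ne => /gsupp_out ->.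
Qed.

Lemma gsumD u v : gsum (u + v) = gsum u + gsum v.
Proof.
pose s := undup (gsupp u ++ gsupp v).
have out w al : {subset gsupp w <= s} -> al \notin s -> gproj al w = 0.
  by move=> sub h; apply: gsupp_out; apply: contra h => /sub.
have su : {subset gsupp u <= s} by move=> x xu; rewrite mem_undup mem_cat xu.
have sv : {subset gsupp v <= s} by move=> x xv; rewrite mem_undup mem_cat xv orbT.
rewrite !(@gsum_sub s) ?undup_uniq //; try by move=> al; apply: out.
  by rewrite -big_split; apply: eq_bigr => al _; rewrite gprojD FD.
by move=> al h; rewrite gprojD !out ?addr0.
Qed.

Lemma gsumZ k v : gsum (k *: v) = k *: gsum v.
Proof.
rewrite (@gsum_sub (gsupp v)); first last.
- by move=> al /gsupp_out; rewrite gprojZ => ->; rewrite scaler0.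
- exact: (gsuppP v).1.
by rewrite scaler_sumr; apply: eq_bigr => al _; rewrite gprojZ FZ.
Qed.

Lemma gsum_homog al v : homog al v -> gsum v = F al v.
Proof.
move=> hv; rewrite (@gsum_sub [:: al]) ?big_seq1 ?hv // => be.
by rewrite inE; apply: homog_gproj_out.
Qed.

End ComponentSums.

End Grading.

(** * The product on homogeneous vectors *)

Section ZhuProduct.
Variables (K : fieldType) (V : lmodType K) (A : QVOA V).
Hypothesis K0 : [pchar K] =i pred0.
Implicit Types (a b c u v w : V) (al be : rat).
Notation homog := (homog A).
Notation Y := (Y A).
Notation res := (res A).
Notation star := (star A).
Notation OV := (OV A).
Notation om := (om A).
Notation vac := (vac A).

Lemma starhE al a b : starh A al a b = if epsq al then res (Num.floor al) (-1) a b else 0.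
Proof. by rewrite /starh; case: ifP => // _; apply: eq_fsum => i; rewrite addrC. Qed.

Lemma resOE al a b : resO A al a b = res (Num.floor al) (-1 - epsz al) a b.
Proof. by apply: eq_fsum => i; congr (_ *: Y a _ b); lia. Qed.

Lemma starhDl al a a' b : starh A al (a + a') b = starh A al a b + starh A al a' b.
Proof. by rewrite !starhE; case: ifP => _; rewrite ?resDl ?addr0. Qed.

Lemma starhZl al k a b : starh A al (k *: a) b = k *: starh A al a b.
Proof. by rewrite !starhE; case: ifP => _; rewrite ?resZl ?scaler0. Qed.

Lemma starDl a a' b : star (a + a') b = star a b + star a' b.
Proof.
by apply: (@gsumD _ _ A _ (fun al x => starh A al x b)) => [al u v|al k v];
  [apply: starhDl | apply: starhZl].
Qed.

Lemma star_homog al a b : homog al a -> star a b = starh A al a b.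
Proof.
by apply: (@gsum_homog _ _ A _ (fun al x => starh A al x b)) => be k v; apply: starhZl.
Qed.

Lemma starZl k a b : star (k *: a) b = k *: star a b.
Proof.
by apply: (@gsumZ _ _ A _ (fun al x => starh A al x b)) => al j v; apply: starhZl.
Qed.

Lemma starDr a b b' : star a (b + b') = star a b + star a b'.
Proof.
rewrite -big_split; apply: eq_bigr => al _ /=.
by rewrite !starhE; case: ifP => _; rewrite ?resDr ?addr0.
Qed.

Lemma starZr k a b : star a (k *: b) = k *: star a b.
Proof.
rewrite scaler_sumr; apply: eq_bigr => al _.
by rewrite !starhE; case: ifP => _; rewrite ?resZr ?scaler0.
Qed.

Lemma star_homogz (m : int) a b : homog m%:~R a -> star a b = res m (-1) a b.
Proof. by move=> /star_homog ->; rewrite starhE epsq_int intrKfloor. Qed.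

Lemma star_nonint al a b : homog al a -> ~~ epsq al -> star a b = 0.
Proof. by move=> /star_homog -> /negPf h; rewrite starhE h. Qed.

Lemma star0l b : star 0 b = 0.
Proof. by rewrite -[0 in LHS](scale0r (0 : V)) starZl scale0r. Qed.
Lemma star0r a : star a 0 = 0.
Proof. by rewrite -[0 in LHS](scale0r (0 : V)) starZr scale0r. Qed.

(** * The subspace O(V) *)

Lemma OV0 : OV 0.
Proof. by exists [::]; rewrite big_nil. Qed.

Lemma OVD u v : OV u -> OV v -> OV (u + v).
Proof.
move=> [s [hs ->]] [t [ht ->]]; exists (s ++ t); rewrite big_cat; split=> // x.
by rewrite mem_cat => /orP[/hs|/ht].
Qed.

Lemma OVZ k u : OV u -> OV (k *: u).
Proof.
move=> [s [hs ->]]; exists [seq (k * t.1.1.1, t.1.1.2, t.1.2, t.2) | t <- s].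
split=> [x /mapP[t /hs ht ->] //|].
by rewrite big_map scaler_sumr; apply: eq_bigr => t _; rewrite scalerA.
Qed.

Lemma OVN u : OV u -> OV (- u).
Proof. by rewrite -scaleN1r; apply: OVZ. Qed.

Lemma OVB u v : OV u -> OV v -> OV (u - v).
Proof. by move=> hu /OVN; apply: OVD. Qed.

Lemma OVZK k u : k != 0 -> OV (k *: u) -> OV u.
Proof. by move=> k0 /(OVZ k^-1); rewrite scalerA mulVf // scale1r. Qed.

Lemma OV_fsum (f : nat -> V) : (forall i, OV (f i)) -> OV (fsum f).
Proof. exact: fsum_closed OV0 OVD. Qed.

Lemma OV_resO al a b : homog al a -> OV (resO A al a b).
Proof.
move=> ha; exists [:: (1, al, a, b)]; split; last by rewrite big_seq1 scale1r.
by move=> t; rewrite inE => /eqP ->.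
Qed.

Lemma OV_ind (P : V -> Prop) : (forall u v, P u -> P v -> P (u + v)) ->
  (forall k u, P u -> P (k *: u)) ->
  (forall al be a b, homog al a -> homog be b -> P (resO A al a b)) ->
  forall u, OV u -> P u.
Proof.
move=> PD PZ Pr u [s [hs ->]].
have P0 : P 0.
  rewrite -(scale0r (resO A 0 0 0)); apply: PZ.
  by apply: (Pr 0 0); apply: homog0.
rewrite big_seq; apply: big_ind => // t /hs ht; apply: PZ.
elim/(@homog_ind _ _ A): t.2 => [b b'|be b hb]; last exact: Pr hb.
by rewrite !resOE resDr; apply: PD.
Qed.

(** * Translation covariance and residues with deeper poles *)

Lemma homog_L al v : homog al v -> homog (al + 1) (Y om 0 v).
Proof.
move=> hv; rewrite (_ : al + 1 = 2%:Q + al - 0%:~R - 1); last by ring.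
exact: homog_Y (om_hom A) hv.
Qed.

(** Integration by parts: Y(L(-1)a, x) is the derivative of Y(a, x), and total derivatives have no
    residue. *)
Lemma res_deriv (p q : int) a b : res p q (Y om 0 a) b
  = - (p%:~R *: res (p - 1) q a b + q%:~R *: res p (q - 1) a b).
Proof.
have [N hN] := Y_truncn A (q - 1) a b.
pose f (i : nat) := (i%:R * binz K p i) *: Y a (q - 1 + i%:Z) b.
have ff : finsupp f by exists N => i /hN; rewrite /f => ->; rewrite scaler0.
have -> : p%:~R *: res (p - 1) q a b = fsum f.
  rewrite fsum_recl // /f mul0r scale0r add0r fsumZ; last exact: res_finsupp.
  apply: eq_fsum => i; have := binz_absorb K0 (p - 1) i.
  rewrite subrK scalerA => ->.
  by congr (_ *: Y a _ b); lia.
rewrite fsumZ; last exact: res_finsupp.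
rewrite -fsumD //; last by exists N => i /hN ->; rewrite !scaler0.
rewrite fsumN; last by exists N => i /hN; rewrite /f => ->; rewrite !scaler0 addr0 .
apply: eq_fsum => i; rewrite /f L_1_deriv !scalerA -scalerDl -scaleNr.
rewrite (_ : q + i%:Z - 1 = q - 1 + i%:Z); last lia.
by congr (_ *: _); rewrite mulrNz intrD; ring.
Qed.

(* (1 + x)^[wt a] x^(-2-eps-n) is, up to lower terms, the derivative of
   (1 + x)^([wt a]+1) x^(-1-eps-n), and L(-1) raises the weight by one. *)
Lemma OV_res_pole (n : nat) al a b : homog al a ->
  OV (res (Num.floor al) (-1 - epsz al - n%:Z) a b).
Proof.
elim: n al a => [|n IH] al a ha; first by rewrite subr0 -resOE; apply: OV_resO.
have e1 : al + 1 = al + 1%:~R by [].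
have := IH _ _ (homog_L ha); rewrite e1 floorDz epszDz res_deriv addrK.
set q := -1 - epsz al - n%:Z => h.
rewrite (_ : -1 - epsz al - n.+1%:Z = q - 1); last by rewrite /q; lia.
(* Since q is at most -1, its image in [K] is invertible, and the residue with one more pole can be
   solved for. *)
have q0 : (- q)%:~R != 0 :> K.
  by apply: intr_neq0 => //; rewrite /q /epsz; case: ifP; lia.
apply: (OVZK q0).
have -> : res (Num.floor al) (q - 1) a b
    = res (Num.floor al + 1) (q - 1) a b - res (Num.floor al) q a b.
  by rewrite (resSp A K0) subrK addrK.
rewrite scalerBr mulrNz scaleNr; apply: OVB; last exact/OVZ/IH.
have opprKD (x y : V) : - y = - (x + y) + x by rewrite opprD addrAC addNr add0r.
rewrite (opprKD ((Num.floor al + 1)%:~R *: res (Num.floor al) q a b)).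
by apply: OVD => //; apply/OVZ/IH.
Qed.

(** Splitting each of the [s] extra factors 1 + x leaves poles that are still deep enough for
    [OV_res_pole]. *)
Lemma OV_res (s n : nat) al a b : homog al a ->
  OV (res (Num.floor al + s%:Z) (-1 - epsz al - (s + n)%N%:Z) a b).
Proof.
move=> ha; elim: s n => [|s IH] n; first by rewrite addr0; apply: OV_res_pole.
rewrite (_ : Num.floor al + s.+1%:Z = Num.floor al + s%:Z + 1); last lia.
rewrite (resSp A K0); apply: OVD.
  by rewrite (_ : (s.+1 + n = s + n.+1)%N); [apply: IH | lia].
by rewrite (_ : _ + 1 = -1 - epsz al - (s + n)%N%:Z); [apply: IH | lia].
Qed.

Lemma Y_vac_ge0 v (n : nat) : Y v n%:Z vac = 0.
Proof. exact: (Y_creation A v).1. Qed.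

Lemma Y_vacN1 v : Y v (-1) vac = v.
Proof. exact: (Y_creation A v).2. Qed.

Lemma OV_nonint al v : homog al v -> ~~ epsq al -> OV v.
Proof.
move=> hv /negPf h; rewrite -[v]Y_vacN1.
have <- : resO A al v vac = Y v (-1) vac; last exact: OV_resO.
rewrite resOE /epsz h subr0.
transitivity (binz K (Num.floor al) 0 *: Y v (-1 + 0%:Z) vac); last first.
  by rewrite binz0 addr0 scale1r.
by apply: fsum_head => i; rewrite (_ : -1 + i.+1%:Z = i%:Z) ?Y_vac_ge0 ?scaler0 //; lia.
Qed.

Lemma OV_res_nonint al be p q a b : homog al a -> homog be b -> ~~ epsq (al + be) ->
  OV (res p q a b).
Proof.
move=> ha hb h; apply: OV_fsum => i; apply: OVZ.
apply: OV_nonint (homog_Y K0 (q + i%:Z) ha hb) _.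
rewrite (_ : al + be - (q + i%:Z)%:~R - 1 = al + be + (- (q + i%:Z) - 1)%:~R).
  by rewrite epsqDz.
by rewrite [in RHS]intrD mulrNz; ring.
Qed.

(** * Associativity and the right ideal property *)

Lemma star_fsuml (f : nat -> V) c : finsupp f -> star (fsum f) c = fsum (fun i => star (f i) c).
Proof. by apply: (@fsum_morph _ _ (fun x => star x c)) => x y; apply: starDl. Qed.

(** In [res_jacobi] with k = n = -1 the r = 0 term of the first sum is [star a (star b c)]; every
    other term has a pole of order at least two and lies in O(V). *)
Lemma star_assoc_int (p q : int) a b c : homog p%:~R a -> homog q%:~R b ->
  OV (star (star a b) c - star a (star b c)).
Proof.
move=> ha hb; rewrite (star_homogz b ha) star_fsuml; last exact: res_finsupp.
have -> : fsum (fun i : nat => star (binz K p i *: Y a (-1 + i%:Z) b) c)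
   = fsum (fun i : nat => binz K p i *: res (p - i%:Z + q) (-1) (Y a (-1 + i%:Z) b) c).
  apply: eq_fsum => i; rewrite starZl; congr (_ *: _); apply: star_homogz.
  have := homog_Y K0 (-1 + i%:Z) ha hb.
  by congr homog; rewrite !intrD !mulrNz; ring.
rewrite (res_jacobi A K0) fsum_recl; last first.
  by have [N hN] := res_truncn A q (-1) b c; exists N => i /hN ->; rewrite res0r scaler0.
rewrite /sbinz binz0 expr0 mulr1 scale1r subr0.
rewrite (star_homogz c hb) (star_homogz _ ha).
rewrite -[X in X - _]addrA addrC addrK; apply: OVB; last apply: OVZ.
  apply: OV_fsum => i; apply: OVZ.
  have := OV_res_pole i (res q (-1 + i.+1%:Z) b c) ha.
  by rewrite intrKfloor /epsz epsq_int; congr (OV (res _ _ _ _)); lia.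
apply: OV_fsum => i; apply: OVZ.
have := OV_res_pole i (res p i%:Z a c) hb.
by rewrite intrKfloor /epsz epsq_int; congr (OV (res _ _ _ _)); lia.
Qed.

Lemma homog_int_ind (P : V -> Prop) : (forall u v, P u -> P v -> P (u + v)) ->
  (forall (m : int) v, homog m%:~R v -> P v) ->
  (forall al v, ~~ epsq al -> homog al v -> P v) -> forall v, P v.
Proof.
move=> PD Pz Pn; apply: (@homog_ind _ _ A) => // al v hv.
case: (boolP (epsq al)) => [/floor_epsq e|h]; last exact: Pn hv.
by apply: (Pz (Num.floor al)); rewrite -e.
Qed.

Lemma star_star_nonint (m : int) be a b c : homog m%:~R a -> homog be b -> ~~ epsq be ->
  star (star a b) c = 0.
Proof.
move=> ha hb h; rewrite (star_homogz b ha) star_fsuml; last exact: res_finsupp.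
apply: fsum0 => i; rewrite starZl (star_nonint _ (homog_Y K0 (-1 + i%:Z) ha hb)) ?scaler0 //.
rewrite (_ : m%:~R + be - (-1 + i%:Z)%:~R - 1 = be + (m - i%:Z)%:~R) ?epsqDz //.
by rewrite !intrD !mulrNz; ring.
Qed.

Lemma star_assoc a b c : OV (star (star a b) c - star a (star b c)).
Proof.
elim/homog_int_ind: a => [a a'|p a ha|al a nal ha].
- by rewrite !starDl opprD addrACA; apply: OVD.
- elim/homog_int_ind: b => [b b'|q b hb|be b nbe hb].
  + by rewrite starDl !starDr starDl opprD addrACA; apply: OVD.
  + exact: star_assoc_int ha hb.
  + rewrite (star_star_nonint c ha hb nbe) (star_nonint _ hb) // star0r subr0.
    exact: OV0.
- rewrite !(star_nonint _ ha) // star0l subr0; exact: OV0.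
Qed.

Lemma OV_star_r u c : OV u -> OV (star u c).
Proof.
elim/OV_ind=> [v w hv hw|k v hv|al be a b ha hb].
- by rewrite starDl; apply: OVD.
- by rewrite starZl; apply: OVZ.
have wt (i : nat) : homog (al + be + (epsz al - i%:Z)%:~R) (Y a (-1 - epsz al + i%:Z) b).
  have := homog_Y K0 (-1 - epsz al + i%:Z) ha hb.
  by congr homog; rewrite !intrD !mulrNz; ring.
rewrite resOE star_fsuml; last exact: res_finsupp.
case: (boolP (epsq (al + be))) => [/floor_epsq|h]; last first.
  rewrite fsum0; first exact: OV0.
  by move=> i; rewrite starZl (star_nonint _ (wt i)) ?scaler0 // epsqDz.
set n := Num.floor (al + be) => en.
(* Chosen so that [al] - i + q is the weight of the mode a_(k+i) b for k = -1 - eps(a); it equals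
   [be] + 1. *)
pose q := n + epsz al - Num.floor al.
have -> : fsum (fun i => star (binz K (Num.floor al) i *: Y a (-1 - epsz al + i%:Z) b) c)
  = fsum (fun i : nat => binz K (Num.floor al) i *:
       res (Num.floor al - i%:Z + q) (-1) (Y a (-1 - epsz al + i%:Z) b) c).
  apply: eq_fsum => i; rewrite starZl; congr (_ *: _); apply: star_homogz.
  have := wt i; rewrite en -intrD; congr (homog _%:~R _).
  by rewrite /q; lia.
have [eq eeps] := floor_eps_complement en.
rewrite (res_jacobi A K0); apply: OVB; last apply: OVZ.
  apply: OV_fsum => r; apply: OVZ.
  exact: OV_res_pole.
apply: OV_fsum => r; apply: OVZ.
(* The exponent is one above [be], but the pole is also one order deeper than in a generator, hence
   [s = 1]. *)
have := OV_res 1 r (res (Num.floor al) r%:Z a c) hb.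
by rewrite eq eeps; congr (OV (res _ _ _ _)); lia.
Qed.

(** * Skew symmetry and commutators modulo O(V) *)

Lemma skew_symmetry (k : int) a b :
  Y b k a = - ((-1) ^ k *: fsum (fun i : nat => (-1) ^+ i *: Y (Y a (k + i%:Z) b) (-1 - i%:Z) vac)).
Proof.
(* With the vacuum as third vector and m = -1, n = 0, creation kills the right side except for b_k
   a_(-1) 1 = b_k a. *)
have := Y_jacobi A a b vac (-1) 0 k; rewrite addr0.
have -> : fsum (fun i : nat => binz K (-1) i *: Y (Y a (k + i%:Z) b) (-1 - i%:Z) vac)
   = fsum (fun i : nat => (-1) ^+ i *: Y (Y a (k + i%:Z) b) (-1 - i%:Z) vac).
  by apply: eq_fsum => i; rewrite binzN1.
move=> ->; rewrite fsum_head => [|i]; last first.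
  rewrite add0r (_ : -1 + i.+1%:Z = i%:Z); last lia.
  by rewrite !Y_vac_ge0 !Y0r scaler0 subrr scaler0.
rewrite binz0 expr0 mulr1 scale1r add0r Y_vac_ge0 Y0r sub0r addr0 Y_vacN1.
by rewrite scalerN opprK scalerA sqr_signz scale1r add0r.
Qed.

(** The generator with second argument the vacuum: Res (1 + x)^m x^(-2) Y(v, x) 1 = v_(-2) 1 + m v,
    and v_(-2) 1 = L(-1)v. *)
Lemma OV_L_wt (m : int) v : homog m%:~R v -> OV (Y om 0 v + m%:~R *: v).
Proof.
move=> hv; have := OV_resO vac hv; rewrite resOE /epsz epsq_int intrKfloor.
suff -> : res m (-1 - 1) v vac = Y om 0 v + m%:~R *: v by [].
transitivity (\sum_(i < 2) binz K m i *: Y v (-1 - 1 + i%:Z) vac).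
  apply: fsumE => -[|[|i]] // _.
  by rewrite (_ : -1 - 1 + i.+2%:Z = i%:Z) ?Y_vac_ge0 ?scaler0 //; lia.
rewrite !big_ord_recl big_ord0 /= binz0 scale1r addr0.
have := binzS K0 m 0; rewrite mul1r binz0 mulr1 subr0 => ->.
rewrite (_ : -1 - 1 + (bump 0 0)%:Z = -1) // Y_vacN1 addr0.
congr (_ + _).
by have := L_1_deriv A v (-1) vac; rewrite Y_vacN1 opprK scale1r => ->.
Qed.

(* Y v (-1 - i) vac is L(-1)^i v / i!, and L(-1) acts as - wt modulo O(V). *)
Lemma OV_divided_L (i : nat) (m : int) v : homog m%:~R v ->
  OV (Y v (-1 - i%:Z) vac - binz K (- m) i *: v).
Proof.
elim: i m v => [|i IH] m v hv.
  by rewrite subr0 Y_vacN1 binz0 scale1r subrr; apply: OV0.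
apply: (OVZK (natr_neq0 K0 i)).
have hL : homog (m + 1)%:~R (Y om 0 v) by rewrite intrD; apply: homog_L.
(* For L(-1)v the mode is (i + 1) v_(-2-i) 1; adding a multiple of L(-1)v + m v then trades L(-1)v
   for -m v. *)
have := IH _ _ hL; rewrite L_1_deriv => h.
have {h} := OVD h (OVZ (binz K (- (m + 1)) i) (OV_L_wt hv)).
rewrite scalerDr addrA subrK scalerBr; congr (OV (_ + _)).
  congr (_ *: Y v _ vac); last lia.
  by rewrite (_ : - (-1 - i%:Z) = i.+1%:Z) //; lia.
rewrite !scalerA -scaleNr; congr (_ *: _).
have := binz_absorb K0 (- (m + 1)) i.
rewrite (_ : - (m + 1) + 1 = - m); last lia.
by move=> ->; rewrite mulrNz mulNr opprK mulrC.
Qed.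

Lemma OV_comm_int (m l : int) a b : homog m%:~R a -> homog l%:~R b ->
  OV (star a b - star b a - res (m - 1) 0 a b).
Proof.
move=> ha hb.
(* [f] expands [star b a] by skew symmetry. [g] replaces each v_(-1-j) 1 by its value modulo O(V),
   with v = a_(-1+i+j) b of weight m + l - i - j. *)
pose f (i j : nat) := (binz K l i * (-1) ^+ (i + j)) *: Y (Y a (-1 + i%:Z + j%:Z) b) (-1 - j%:Z) vac.
pose g (i j : nat) := (binz K l i * (-1) ^+ (i + j) * binz K (- (m + l - i%:Z - j%:Z)) j)
   *: Y a (-1 + i%:Z + j%:Z) b.
have [N hN] := Y_truncn A (-1) a b.
have ff : finsupp2 f.
  by exists N => i j /hN; rewrite /f -(addrA (-1)) -PoszD => ->; rewrite Y0l scaler0.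
have fg : finsupp2 g.
  by exists N => i j /hN; rewrite /g -(addrA (-1)) -PoszD => ->; rewrite scaler0.
have ef : star b a = fsum (fun i => fsum (f i)).
  rewrite (star_homogz a hb); apply: eq_fsum => i.
  rewrite skew_symmetry -scaleNr scalerA fsumZ.
    apply: eq_fsum => j; rewrite scalerA /f; congr (_ *: _).
    rewrite exprD mulrA; congr (_ * _ * _).
    rewrite (_ : -1 + i%:Z = i%:Z - 1); last lia.
    rewrite expfzDr ?oppr_eq0 ?oner_eq0 // exprN1 invrN1 mulrN1 opprK //.
  by have [T hT] := Y_truncn A (-1 + i%:Z) a b; exists T => j /hT ->; rewrite Y0l scaler0.
(* Along i + j = s, Vandermonde gives (-1)^s binom(s - m, s), which is binom(m - 1, s) by upper
   negation. *)
have eg : res (m - 1) (-1) a b = fsum (fun i => fsum (g i)).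
  rewrite fsum_triangle //; apply: eq_fsum => s.
  transitivity (\sum_(i < s.+1) ((-1) ^+ s * (binz K l i * binz K (s%:Z - m - l) (s - i)))
       *: Y a (-1 + s%:Z) b).
    rewrite -scaler_suml -mulr_sumr binz_vandermonde //.
    by rewrite (_ : l + (s%:Z - m - l) = s%:Z - m) ?binz_neg //; lia.
  apply: eq_bigr => i _; have le : (i <= s)%N by rewrite -ltnS.
  rewrite /g subnKC // mulrA [(-1) ^+ s * _]mulrC.
  by congr ((_ * binz K _ _) *: Y a _ b); lia.
have efg : OV (star b a - res (m - 1) (-1) a b).
  rewrite ef eg -fsumB; try exact: finsupp_fsum.
  apply: OV_fsum => i; rewrite -fsumB; try exact: finsupp2_row.
  apply: OV_fsum => j; rewrite /f /g -[X in _ - X]scalerA -scalerBr; apply: OVZ.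
  apply: OV_divided_L; have := homog_Y K0 (-1 + i%:Z + j%:Z) ha hb.
  by congr homog; rewrite !intrD !mulrNz; ring.
(* [star a b] has one more factor 1 + x than the residue congruent to [star b a], which leaves the
   residue without pole. *)
have -> : star a b = res (m - 1) (-1) a b + res (m - 1) 0 a b.
  by rewrite (star_homogz b ha) -{1}[m](subrK 1) (resSp A K0).
rewrite addrAC addrK -opprB; exact: OVN.
Qed.

Lemma OV_comm (m : int) a w : homog m%:~R a ->
  OV (star a w - star w a - res (m - 1) 0 a w).
Proof.
move=> ha; elim/homog_int_ind: w => [u v hu hv|l b hb|be b nbe hb].
- have := OVD hu hv; rewrite starDl starDr resDr; congr (OV _).
  by rewrite addrACA [X in X + _ = _]addrACA -!opprD.
- exact: OV_comm_int ha hb.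
have nab : ~~ epsq (m%:~R + be) by rewrite epsqD ?epsq_int.
rewrite (star_nonint _ hb nbe) subr0 (star_homogz b ha).
by apply: OVB; apply: OV_res_nonint ha hb nab.
Qed.

(** With k = 0, [res_jacobi] is a commutator formula: moving [a] past a generator built on b leaves
    residues built on a_l b. Its weight be + m - l - 1 makes the exponent exactly right for a
    generator. *)
Lemma OV_res_l (m : int) a u : homog m%:~R a -> OV u -> OV (res (m - 1) 0 a u).
Proof.
move=> ha; elim/OV_ind=> [v w hv hw|k v hv|be ga b c hb _].
- by rewrite resDr; apply: OVD.
- by rewrite resZr; apply: OVZ.
have s0 (F : nat -> V) : fsum (fun r => sbinz K 0 r *: F r) = F 0%N.
  rewrite fsum_head /sbinz => [|r]; first by rewrite binz0 mulr1 scale1r.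
  by rewrite binz_0 mulr0 scale0r.
have := res_jacobi A K0 (m - 1) (Num.floor be) (-1 - epsz be) 0 a b c.
rewrite !s0 /= !scale1r !subr0 -resOE => /eqP; rewrite eq_sym subr_eq => /eqP ->.
apply: OVD; last by rewrite -resOE; apply: OV_resO.
apply: OV_fsum => l; apply: OVZ.
have hl : homog (be + (m - l%:Z - 1)%:~R) (Y a (0 + l%:Z) b).
  have := homog_Y K0 (0 + l%:Z) ha hb.
  by congr homog; rewrite !intrD !mulrNz; ring.
have := OV_resO c hl; rewrite resOE floorDz epszDz.
by congr (OV (res _ _ _ _)); lia.
Qed.

Lemma OV_star_l a u : OV u -> OV (star a u).
Proof.
move=> hu; elim/homog_int_ind: a => [a a'|m a ha|al a nal ha].
- by rewrite starDl; apply: OVD.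
- have := OVD (OV_comm u ha) (OVD (OV_res_l ha hu) (OV_star_r a hu)).
  by rewrite addrA !subrK.
- by rewrite (star_nonint _ ha nal); apply: OV0.
Qed.

(** * Identity and centrality of the conformal vector *)

Lemma star_vac_l a : star vac a = a.
Proof.
rewrite (@star_homogz 0) ?vac_hom //; last exact: vac_hom.
transitivity (binz K 0 0 *: Y vac (-1 + 0%:Z) a).
  by apply: fsum_head => i; rewrite binz_0 scale0r.
by rewrite binz0 scale1r Y_vac addr0 eqxx.
Qed.

Lemma star_vac_r a : OV (star a vac - a).
Proof.
elim/homog_int_ind: a => [a a'|m a ha|al a nal ha].
- by rewrite starDl opprD addrACA; apply: OVD.
- suff -> : star a vac = a by rewrite subrr; apply: OV0.
  rewrite (star_homogz vac ha).
  transitivity (binz K m 0 *: Y a (-1 + 0%:Z) vac).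
    apply: fsum_head => i; rewrite (_ : -1 + i.+1%:Z = i%:Z); last lia.
    by rewrite Y_vac_ge0 scaler0.
  by rewrite binz0 scale1r addr0 Y_vacN1.
- by rewrite (star_nonint _ ha nal) sub0r; apply/OVN/(OV_nonint ha nal).
Qed.

Lemma star_om_central a : OV (star om a - star a om).
Proof.
elim/homog_int_ind: a => [a a' ha ha'|m a ha|al a nal ha].
- by rewrite starDl starDr opprD addrACA; apply: OVD.
- have := OV_comm a (om_hom A : homog 2%:~R om).
  move=> /OVD h; rewrite -[star om a - _](subrK (res 1 0 om a)); apply: h.
  (* As [om] has weight 2, the commutator is Res (1 + x) Y(om, x) a = L(-1)a + L(0)a. *)
  suff -> : res 1 0 om a = Y om 0 a + m%:~R *: a by apply: OV_L_wt.
  transitivity (\sum_(i < 2) binz K 1 i *: Y om (0 + i%:Z) a).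
    by apply: fsumE => i lt; rewrite (@binz_small K 1) ?scale0r.
  rewrite !big_ord_recl big_ord0 /= binz0 (@binz_nn K K0 1) !scale1r !addr0.
  by rewrite -(ratr_int K m) -(L0_grade ha) !add0r.
- rewrite (star_nonint _ ha nal) subr0 (@star_homogz 2) ?om_hom //; last exact: om_hom.
  apply: OV_res_nonint (om_hom A) ha _.
  by rewrite epsqD ?epsq_int.
Qed.

End ZhuProduct.

(** * The action on Omega(M) *)

Section OmegaModule.
Variables (K : fieldType) (V : lmodType K) (A : QVOA V).
Variables (M : lmodType K) (W : wmod A M).
Hypothesis K0 : [pchar K] =i pred0.
Implicit Types (a b : V) (u : M) (al be : rat).
Notation homog := (homog A).
Notation Y := (Y A).
Notation YM := (YM W).
Notation star := (star A).
Notation oact := (oact W).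
Notation Omega := (Omega W).

Lemma YMDl a a' n u : YM (a + a') n u = YM a n u + YM a' n u.
Proof. by have := YM_linl W 1 a a' n u; rewrite !scale1r. Qed.
Lemma YM0l n u : YM 0 n u = 0.
Proof. by apply: (addIr (YM 0 n u)); rewrite -YMDl !add0r. Qed.
Lemma YMZl k a n u : YM (k *: a) n u = k *: YM a n u.
Proof. by have := YM_linl W k a 0 n u; rewrite YM0l !addr0. Qed.
Lemma YMDr a n u u' : YM a n (u + u') = YM a n u + YM a n u'.
Proof. by have := YM_linr W 1 a n u u'; rewrite !scale1r. Qed.
Lemma YM0r a n : YM a n 0 = 0.
Proof. by apply: (addIr (YM a n 0)); rewrite -YMDr !add0r. Qed.

Lemma oactDl a a' u : oact (a + a') u = oact a u + oact a' u.
Proof.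
by apply: (@gsumD _ _ A _ (fun al x => if epsq al then YM x (Num.floor al - 1) u else 0))
  => [al x y|al k x]; case: ifP => _; rewrite ?YMDl ?YMZl ?addr0 ?scaler0.
Qed.

Lemma oactZl k a u : oact (k *: a) u = k *: oact a u.
Proof.
by apply: (@gsumZ _ _ A _ (fun al x => if epsq al then YM x (Num.floor al - 1) u else 0))
  => al j x; case: ifP => _; rewrite ?YMZl ?scaler0.
Qed.

Lemma oact_homog al a u : homog al a ->
  oact a u = if epsq al then YM a (Num.floor al - 1) u else 0.
Proof.
by apply: (@gsum_homog _ _ A _ (fun al x => if epsq al then YM x (Num.floor al - 1) u else 0))
  => be j x; case: ifP => _; rewrite ?YMZl ?scaler0.
Qed.

Lemma oact_homogz (m : int) a u : homog m%:~R a -> oact a u = YM a (m - 1) u.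
Proof. by move=> /oact_homog ->; rewrite epsq_int intrKfloor. Qed.

Lemma oact_nonint al a u : homog al a -> ~~ epsq al -> oact a u = 0.
Proof. by move=> /oact_homog -> /negPf ->. Qed.

Lemma oact0l u : oact 0 u = 0.
Proof. by rewrite -[0 in LHS](scale0r (0 : V)) oactZl scale0r. Qed.

Lemma oact0r a : oact a 0 = 0.
Proof. by apply: big1 => al _; case: ifP => _; rewrite ?YM0r. Qed.

Lemma oactDr a u u' : oact a (u + u') = oact a u + oact a u'.
Proof.
rewrite -big_split; apply: eq_bigr => al _ /=.
by case: ifP => _; rewrite ?YMDr ?addr0.
Qed.

Lemma oact_fsuml (f : nat -> V) u : finsupp f -> oact (fsum f) u = fsum (fun i => oact (f i) u).
Proof. by apply: (@fsum_morph _ _ (fun x => oact x u)) => x y; apply: oactDl. Qed.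

Lemma Omega_lin (k : K) u v : Omega u -> Omega v -> Omega (k *: u + v).
Proof.
move=> hu hv al a ha m lt.
by rewrite YM_linr (hu al) // (hv al) // scaler0 addr0.
Qed.

Lemma Omega0 : Omega 0.
Proof. by move=> al a _ m _; rewrite YM0r. Qed.

Lemma OmegaD u v : Omega u -> Omega v -> Omega (u + v).
Proof. by move=> hu hv; rewrite -[u]scale1r; apply: Omega_lin. Qed.

(** [al] > al - 1 for every weight, so all modes from [al] on kill [u], integral weight or not. *)
Lemma Omega_floor al a u (i : nat) : homog al a -> Omega u ->
  YM a (Num.floor al + i%:Z) u = 0.
Proof.
move=> ha hu; apply: (hu al) => //.
have /andP[_] := floor_itv al; have : 0 <= i%:~R :> rat by rewrite ler0n.
by rewrite !intrD => h0 h1; lra.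
Qed.

Lemma Omega_floorz (m : int) a u (i : nat) : homog m%:~R a -> Omega u ->
  YM a (m + i%:Z) u = 0.
Proof. by move=> ha hu; have := Omega_floor i ha hu; rewrite intrKfloor. Qed.

Lemma Omega_oact a u : Omega u -> Omega (oact a u).
Proof.
move=> hu; elim/(homog_int_ind (A := A)): a => [a a'|m a ha|al a nal ha].
- by rewrite oactDl; apply: OmegaD.
- rewrite (oact_homogz u ha) => be b hb k lt.
  (* Commutator formula for b_k and a_(m-1). The mode of each b_i a that occurs exceeds its own
     threshold by the same amount as b_k does, so it kills [u]. *)
  have := YM_jacobi W b a u k (m - 1) 0.
  rewrite fsum0 => [|i]; last first.
    rewrite (hu _ _ (homog_Y K0 (0 + i%:Z) hb ha)) ?scaler0 //.
    by rewrite !intrD !mulrNz; lra.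
  rewrite fsum_head => [|i]; last by rewrite binz_0 mulr0 scale0r.
  rewrite binz0 expr0 mulr1 !scale1r !subr0 (hu be b) // YM0r subr0.
  by move=> <-.
- by rewrite (oact_nonint _ ha nal); apply: Omega0.
Qed.

(** The Borcherds identity with m = [al], n = [be], k = -1 - eps(a): every term on the right applies
    a mode from [al] or [be] on directly to [u]. The complement formula shows that the modes on the
    left are those of [oact]. *)
Lemma oact_OV a u : OV A a -> Omega u -> oact a u = 0.
Proof.
move=> ha hu; elim/(OV_ind (A := A)): ha => [v w hv hw|k v hv|al be {}a b ha hb].
- by rewrite oactDl hv hw addr0.
- by rewrite oactZl hv scaler0.
have wt (i : nat) : homog (al + be + (epsz al - i%:Z)%:~R) (Y a (-1 - epsz al + i%:Z) b).
  have := homog_Y K0 (-1 - epsz al + i%:Z) ha hb.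
  by congr homog; rewrite !intrD !mulrNz; ring.
rewrite resOE oact_fsuml; last exact: res_finsupp.
case: (boolP (epsq (al + be))) => [/floor_epsq|h]; last first.
  by apply: fsum0 => i; rewrite oactZl (oact_nonint _ (wt i)) ?scaler0 // epsqDz.
set n := Num.floor (al + be) => en.
have [ebe _] := floor_eps_complement en.
transitivity (fsum (fun i : nat => binz K (Num.floor al) i *:
  YM (Y a (-1 - epsz al + i%:Z) b) (Num.floor al + Num.floor be - i%:Z) u)).
  apply: eq_fsum => i; rewrite oactZl; congr (_ *: _).
  have := wt i; rewrite en -intrD => /oact_homogz ->.
  by congr (YM _ _ u); lia.
rewrite YM_jacobi; apply: fsum0 => i.
by rewrite (Omega_floor i ha hu) (Omega_floor i hb hu) !YM0r scaler0 subrr scaler0.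
Qed.

(** The Borcherds identity with m = p, n = q - 1, k = -1: on [u] only the term a_(p-1) b_(q-1) u
    survives on the right. *)
Lemma oact_star_int (p q : int) a b u : homog p%:~R a -> homog q%:~R b -> Omega u ->
  oact (star a b) u = oact a (oact b u).
Proof.
move=> ha hb hu.
rewrite (star_homogz b ha) oact_fsuml; last exact: res_finsupp.
transitivity (fsum (fun i : nat => binz K p i *:
  YM (Y a (-1 + i%:Z) b) (p + (q - 1) - i%:Z) u)).
  apply: eq_fsum => i; rewrite oactZl; congr (_ *: _).
  have : homog (p + q - i%:Z)%:~R (Y a (-1 + i%:Z) b).
    have := homog_Y K0 (-1 + i%:Z) ha hb.
    by congr homog; rewrite !intrD !mulrNz; ring.
  by move=> /oact_homogz ->; congr (YM _ _ u); lia.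
rewrite YM_jacobi (oact_homogz u hb) (oact_homogz _ ha).
rewrite fsum_head => [|i]; last first.
  rewrite (_ : q - 1 + i.+1%:Z = q + i%:Z); last lia.
  by rewrite (Omega_floorz i hb hu) (Omega_floorz _ ha hu) !YM0r scaler0 subrr scaler0.
rewrite binz0 expr0 mulr1 scale1r (Omega_floorz _ ha hu) YM0r scaler0.
by rewrite !subr0.
Qed.

Lemma oact_star a b u : Omega u -> oact (star a b) u = oact a (oact b u).
Proof.
move=> hu; elim/(homog_int_ind (A := A)): a => [a a' h h'|p a ha|al a nal ha].
- by rewrite starDl !oactDl h h'.
- elim/(homog_int_ind (A := A)): b => [b b' h h'|q b hb|be b nbe hb].
  + by rewrite starDr !oactDl oactDr h h'.
  + exact: oact_star_int ha hb hu.
  + rewrite (oact_nonint _ hb nbe) oact0r (star_homogz b ha).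
    rewrite oact_fsuml; last exact: res_finsupp.
    apply: fsum0 => i.
    rewrite oactZl (oact_nonint _ (homog_Y K0 (-1 + i%:Z) ha hb)) ?scaler0 //.
    rewrite (_ : _ - 1 = be + (p - i%:Z)%:~R) ?epsqDz //.
    by rewrite !intrD !mulrNz; ring.
- by rewrite (star_nonint _ ha nal) oact0l (oact_nonint _ ha nal).
Qed.

Lemma oact_vac u : oact (vac A) u = u.
Proof. by rewrite (@oact_homogz 0) ?YM_vac //; apply: vac_hom. Qed.

End OmegaModule.

Theorem theorem3p2 (K : fieldType) (V : lmodType K) (A : QVOA V) :
  [pchar K] =i pred0 ->
  (* (a) O(V) is a two-sided ideal for *, A(V) = V/O(V) is associative with
     identity 1 + O(V), and omega + O(V) is central *)
  ((forall (k : K) u v, OV A u -> OV A v -> OV A (k *: u + v)) /\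
   (forall u v, OV A u -> OV A (star A u v) /\ OV A (star A v u)) /\
   (forall a b c, OV A (star A (star A a b) c - star A a (star A b c))) /\
   (forall a, OV A (star A (vac A) a - a) /\ OV A (star A a (vac A) - a)) /\
   (forall a, OV A (star A (om A) a - star A a (om A)))) /\
  (* (b) Omega(M) is an A(V)-module with a + O(V) acting as o(a) *)
  (forall (M : lmodType K) (W : wmod A M),
    (forall (k : K) u v, Omega W u -> Omega W v -> Omega W (k *: u + v)) /\
    (forall a u, Omega W u -> Omega W (oact W a u)) /\
    (forall a u, OV A a -> Omega W u -> oact W a u = 0) /\
    (forall a b u, Omega W u -> oact W (star A a b) u = oact W a (oact W b u)) /\
    (forall u, Omega W u -> oact W (vac A) u = u)).
Proof.
move=> K0; split; last first.
  move=> M W; split; first by move=> k u v; apply: Omega_lin.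
  split; first by move=> a u; apply: Omega_oact.
  split; first by move=> a u; apply: oact_OV.
  split; first by move=> a b u; apply: oact_star.
  by move=> u _; apply: oact_vac.
split; first by move=> k u v hu hv; apply: OVD => //; apply: OVZ.
split; first by move=> u v hu; split; [apply: OV_star_r | apply: OV_star_l].
split; first exact: star_assoc.
split; last exact: star_om_central.
move=> a; split; last exact: star_vac_r.
by rewrite star_vac_l // subrr; apply: OV0.
Qed.
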